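(* Let $w_1,\dots,w_n$ ($n=d+1$) be positive integers with $\gcd(w_1,\dots,w_n)=1$ and $w_i\mid W:=\sum_jw_j$ for all $i$; let $v_1,\dots,v_n$ generate $M\cong\mathbb Z^d$ with $\sum_iw_iv_i=0$, $\Delta=\mathrm{conv}\{v_1,\dots,v_n\}$ (a reflexive simplex), and $f(t)=1-\sum_{i=1}^na_it^{v_i}$. For any homogeneous $P\in\mathbb Q[x_1,\dots,x_n]$ of degree $d$, the toric residue $$R_P(a)=(-1)^d\mathrm{Res}_f\big(t_0^dP(a_1t^{v_1},\dots,a_nt^{v_n})\big)$$ depends only on $y=a_1^{w_1}\cdots a_n^{w_n}$ and equals $$R_P(y)=\frac{\nu\,P(w_1,\dots,w_n)}{1-\mu y},\qquad \nu=\frac1{w_1\cdots w_n},\quad \mu=\frac{W^{W}}{\prod_{i=1}^nw_i^{w_i}}.$$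
   Context: For a reflexive $d$-dimensional lattice polytope $\Delta\subset M_{\mathbb R}$, $S_\Delta=\bigoplus_kS^k_\Delta\subset\mathbb C[t_0,t^{\pm1}]$ with $S^k_\Delta$ spanned by $t_0^kt^m$, $m\in k\Delta\cap M$. For a Laurent polynomial $f$ supported in $\Delta$ put $f_i=t_i\partial f/\partial t_i$, $F_0=t_0f$, $F_i=t_0f_i$; for $\Delta$-regular $f$ (i.e. $F_0,\dots,F_d$ regular in $S_\Delta$) let $H'_f=t_0^d\det M_f$, $M_f$ the $(d+1)\times(d+1)$ matrix with first row and first column $(f,f_1,\dots,f_d)$ and $(i,j)$-entry $t_i\partial f_j/\partial t_i$ for $1\le i,j\le d$. The toric residue $\mathrm{Res}_f:S^d_\Delta\to\mathbb C$ is the linear map vanishing on $\sum_iF_iS^{d-1}_\Delta$ with $\mathrm{Res}_f(H'_f)=\mathrm{Vol}(\Delta)$ ($d!$ times Euclidean volume); it is a rational function of the coefficients of $f$, and the identity is one of rational functions of $a$. *)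

(* Defs.v *)
From HB Require Import structures.
From mathcomp Require Import all_boot all_order all_algebra all_fingroup.
From mathcomp Require Import mpoly.
Set Implicit Arguments. Unset Strict Implicit. Unset Printing Implicit Defensive.
Import Order.TTheory GRing.Theory Num.Theory.
Local Open Scope ring_scope.

(* The lattice M = Z^d is 'rV[int]_d.  An element of
   C[t_0, t^{+-1}] is represented as a formal finite sum of terms
   (c, (k, m)) standing for c * t_0^k * t^m; two formal sums denote the
   same Laurent polynomial iff they have the same coefficient function
   [lcoef].  All operations below are the literal operations on such sums. *)

Notation Exp d := (nat * 'rV[int]_d)%type.
Notation LP C d := (seq (C * Exp d)).

Section Laurent.
Variables (C : numClosedFieldType) (d : nat).
Local Notation Exp := (Exp d).
Local Notation LP := (LP C d).

Definition eadd (e e' : Exp) : Exp := ((e.1 + e'.1)%N, e.2 + e'.2).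

Definition lcoef (p : LP) (e : Exp) : C := \sum_(x <- p | x.2 == e) x.1.
Definition lequiv (p q : LP) := forall e, lcoef p e = lcoef q e.

Definition lzero : LP := [::].
Definition lmon (c : C) (e : Exp) : LP := [:: (c, e)].
Definition lone : LP := lmon 1 (0%N, 0).
Definition ladd (p q : LP) : LP := p ++ q.
Definition lscale (c : C) (p : LP) : LP := [seq (c * x.1, x.2) | x <- p].
Definition lmul (p q : LP) : LP :=
  [seq (x.1 * y.1, eadd x.2 y.2) | x <- p, y <- q].
(* t_i d/dt_i  (i = 1..d, indexed by 'I_d) *)
Definition ltder (i : 'I_d) (p : LP) : LP :=
  [seq (x.1 * ((x.2.2 : 'rV[int]_d) 0 i)%:~R, x.2) | x : C * Exp <- p].

Definition ldet k (A : 'I_k -> 'I_k -> LP) : LP :=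
  \big[ladd/lzero]_(s : 'S_k)
     lscale ((-1) ^+ s) (\big[lmul/lone]_(i : 'I_k) A i (s i)).

End Laurent.

Section Toric.
Variables (C : numClosedFieldType) (d : nat).
Local Notation n := d.+1.
Variable v : 'I_n -> 'rV[int]_d.

(* m is a lattice point of k*Delta, Delta = conv{v_1,...,v_n}
   (barycentric coordinates of a lattice point of a lattice simplex are rational) *)
Definition in_kDelta (k : nat) (m : 'rV[int]_d) : Prop :=
  exists lam : 'I_n -> rat,
    (forall i, 0 <= lam i) /\ \sum_i lam i = k%:R /\
    forall j, (m 0 j)%:~R = \sum_i lam i * (v i 0 j)%:~R.

Definition in_S (p : LP C d) : Prop :=
  forall e, lcoef p e != 0 -> in_kDelta e.1 e.2.

Definition in_Sk (k : nat) (p : LP C d) : Prop :=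
  in_S p /\ forall e, lcoef p e != 0 -> e.1 = k.

(* normalized volume d! vol(Delta) of the lattice simplex:
   |det| of the (d+1)x(d+1) matrix with rows (1, v_i) *)
Definition simplex_vol : int :=
  `|\det (\matrix_(i < n, j < n)
          if unlift ord0 j is Some j' then v i 0 j' else 1)|.

Variable a : 'I_n -> C.

Definition fpol : LP C d :=
  ladd (lone C d) [seq (- a i, (0%N, v i)) | i <- enum 'I_n].

Definition tdop (i : 'I_n) (p : LP C d) : LP C d :=
  if unlift ord0 i is Some j then ltder j p else p.

Definition Fgen (i : 'I_n) : LP C d :=
  lmul (lmon 1 (1%N, 0)) (tdop i fpol).

(* M_f : first row/column (f, f_1, ..., f_d), (i,j) entry t_i d f_j / d t_i *)
Definition Mf (i j : 'I_n) : LP C d := tdop i (tdop j fpol).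

Definition Hprime : LP C d := lmul (lmon 1 (d, 0)) (ldet Mf).

Definition in_ideal (i : nat) (p : LP C d) : Prop :=
  exists h : 'I_n -> LP C d, (forall j, in_S (h j)) /\
    lequiv p (\big[@ladd C d/lzero C d]_(j < n | (j < i)%N) lmul (Fgen j) (h j)).

Definition Delta_regular : Prop :=
  (forall i : 'I_n, forall g : LP C d, in_S g ->
     in_ideal i (lmul (Fgen i) g) -> in_ideal i g) /\
  ~ in_ideal n (lone C d).

(* A linear form on S^d_Delta, given by its values r m on the basis
   monomials t_0^d t^m (m in d*Delta); evaluation on p in S^d_Delta: *)
Definition resval (r : 'rV[int]_d -> C) (p : LP C d) : C :=
  \sum_(x <- p) x.1 * r x.2.2.

Definition is_toric_residue (r : 'rV[int]_d -> C) : Prop :=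
  (forall (k : nat) (h : LP C d), k.+1 = d -> in_Sk k h ->
     forall i, resval r (lmul (Fgen i) h) = 0) /\
  resval r Hprime = (simplex_vol)%:~R.

Definition Psubst (P : {mpoly rat[n]}) : LP C d :=
  [seq (ratr (P@_m) * \prod_(i < n) a i ^+ (m i),
        (d, \sum_(i < n) v i *~ (m i)%:Z)) | m <- mpoly.msupp P].

End Toric.

Definition homog_of_deg n (k : nat) (P : {mpoly rat[n]}) : Prop :=
  forall m, m \in mpoly.msupp P -> mpoly.mdeg m = k.

(* Main.v *)
(** Write W = \sum_i w_i, Z_i = t_0 a_i t^(v_i) and T = t_0. The homogeneous
    coordinates (1, v_i) form a matrix A with det A = +-W and w A = (W, 0), so
    the linear forms F_0, ..., F_d generate exactly the relations
    Z_i = (w_i / W) T; hence a residue r satisfies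
    r(Z_i h) = (w_i / W) r(T h) for h in S^(d-1), and
    r(t_0^d P(Z)) = P(w) W^(-d) r(T^d). It remains to compute r(T^d) from the
    normalisation on H'.

    As M_f = A^T (diag(-Z_i) + w^T w / W^2) A (up to powers of t_0), H' is a
    combination of the products of d distinct Z_i and of Z_1 ... Z_n / T. The
    latter monomial has barycentric coordinates 1 - w_i / W in d Delta. It is
    reached from a product of d factors Z_i by W - 1 exchanges of some Z_i for T:
    an exchange is possible as long as a barycentric coordinate is at least 1,
    and divisibility of W by the w_i together with gcd(w) = 1 shows that this
    fails only at the monomial wanted. The passage from \prod Z_i^(w_i) to
    y T^W produces the factor mu y. *)
Require Import Defs.
From HB Require Import structures.
From mathcomp Require Import all_boot all_order all_algebra all_fingroup.
From mathcomp Require Import mpoly ssrcomplements.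
From mathcomp Require Import ring zify.
Set Implicit Arguments. Unset Strict Implicit. Unset Printing Implicit Defensive.
Import Order.TTheory GRing.Theory Num.Theory.
Local Open Scope ring_scope.

(** * A determinant formula and divisibility by a gcd *)

(** By linearity in the first row, which is [D ord0] times a unit vector plus [u ord0] times [v].
    The first summand leads to the block triangular [B], the second to [E], a product of two
    triangular matrices. No [D i] is inverted, so polynomial entries are allowed. *)
Lemma det_diag_rank1 (R : comNzRingType) n (D u v : 'I_n -> R) :
  \det (\matrix_(i, j) (D i *+ (i == j) + u i * v j)) =
  \prod_i D i + \sum_j u j * v j * \prod_(i | i != j) D i.
Proof.
elim: n D u v => [|n IHn] D u v; first by rewrite det_mx00 !big_ord0 addr0.
pose D' i := D (lift ord0 i); pose u' i := u (lift ord0 i).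
pose v' i := v (lift ord0 i).
set A := (X in \det X).
pose B : 'M[R]_(1 + n) := block_mx (D ord0)%:M 0 (\col_i (u' i * v ord0))
  (\matrix_(i, j) (D' i *+ (i == j) + u' i * v' j)).
pose E : 'M[R]_(1 + n) := block_mx 1%:M 0 (\col_i u' i) 1%:M *m
  block_mx (v ord0)%:M (\row_j v' j) 0 (diag_mx (\row_j D' j)).
have EE : E = block_mx (v ord0)%:M (\row_j v' j) (\col_i (u' i * v ord0))
    (\matrix_(i, j) (D' i *+ (i == j) + u' i * v' j)).
  rewrite /E mulmx_block !mul1mx !mulmx0 !mul0mx !addr0.
  congr block_mx; apply/matrixP => i j; rewrite !mxE big_ord1 !mxE.
    by rewrite !ord1 mulr1n.
  by rewrite addrC; congr (_ + _); rewrite eq_sym; case: eqP => // ->.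
have split0 : split (ord0 : 'I_(1 + n)) = inl ord0.
  by rewrite -(unsplitK (inl ord0)); congr split; apply/val_inj.
have splitS (i : 'I_n) : split (lift ord0 i : 'I_(1 + n)) = inr i.
  by rewrite -(unsplitK (inr i)); congr split; apply/val_inj.
have -> : \det A = 1 * \det B + u ord0 * \det E.
  rewrite EE; apply: (determinant_multilinear (i0 := ord0)).
  - apply/rowP => j; rewrite !mxE split0.
    case: (unliftP ord0 j) => [j'|] ->; rewrite !mxE ?(split0, splitS) !mxE.
      by rewrite (negbTE (neq_lift _ _)) mulr0 /= !add0r.
    by rewrite !mulr1n mul1r.
  - apply/matrixP => i j; rewrite !mxE splitS.
    case: (unliftP ord0 j) => [j'|] ->; rewrite !mxE ?(split0, splitS) !mxE.
      by rewrite (inj_eq lift_inj).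
    by rewrite add0r.
  - apply/matrixP => i j; rewrite !mxE splitS.
    case: (unliftP ord0 j) => [j'|] ->; rewrite !mxE ?(split0, splitS) !mxE.
      by rewrite (inj_eq lift_inj).
    by rewrite add0r.
rewrite /E det_mulmx det_lblock det_ublock /B det_lblock IHn !det1 det_diag.
rewrite !det_scalar1 !mul1r big_ord_recl [in RHS]big_ord_recl /=.
have -> : \prod_(i < n.+1 | i != ord0) D i = \prod_(i < n) D' i.
  rewrite big_mkcond big_ord_recl /= mul1r; apply: eq_bigr => i _.
  by [].
have -> : \prod_(i < n) (\row_j D' j) 0 i = \prod_(i < n) D' i.
  by apply: eq_bigr => i _; rewrite mxE.
rewrite mulrDr mulr_sumr -addrA [X in _ + X]addrC mulrA; congr (_ + (_ + _)).
apply: eq_bigr => j _; rewrite mulrCA; congr (_ * _).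
rewrite [in RHS]big_mkcond big_ord_recl /=; congr (_ * _).
by rewrite big_mkcond; apply: eq_bigr => i _; rewrite (inj_eq lift_inj).
Qed.

Lemma dvdn_mul_biggcd n (w : 'I_n -> nat) (N x : nat) :
  (forall i, N %| w i * x)%N -> (N %| (\big[gcdn/0]_i w i) * x)%N.
Proof.
move=> dvdN; apply: (big_ind (fun g => N %| g * x)%N) => [|g h Ng Nh|i _].
- by rewrite mul0n dvdn0.
- by rewrite muln_gcdl dvdn_gcd Ng.
- exact: dvdN.
Qed.

(** * Linear functionals given by their values on monomials *)

Section MonomialFunctional.

Variables (C : comNzRingType) (n : nat) (g : 'X_{1.. n} -> C).

Definition mnmfun (q : {mpoly C[n]}) : C := \sum_(m <- msupp q) q@_m * g m.

(** An index set independent of the support of [q] lets the sums for different polynomials be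
    compared term by term. *)
Lemma mnmfunE k (q : {mpoly C[n]}) : (msize q <= k)%N ->
  mnmfun q = \sum_(m : 'X_{1..n < k}) q@_m * g m.
Proof.
move=> le_qk; set I : subFinType _ := 'X_{1..n < k}.
rewrite /mnmfun (big_mksub I) ?msupp_uniq //=; last first.
  by move=> m /msize_mdeg_lt /leq_trans; apply.
by rewrite big_rmcond //= => m /memN_msupp_eq0 ->; rewrite mul0r.
Qed.

Lemma mnmfunD p q : mnmfun (p + q) = mnmfun p + mnmfun q.
Proof.
pose k := maxn (msize (p + q)) (maxn (msize p) (msize q)).
rewrite !(@mnmfunE k) ?leq_max ?leqnn ?orbT // -big_split /=.
by apply: eq_bigr => m _; rewrite mcoeffD mulrDl.
Qed.

Lemma mnmfunZ c p : mnmfun (c *: p) = c * mnmfun p.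
Proof.
pose k := maxn (msize (c *: p)) (msize p).
rewrite !(@mnmfunE k) ?leq_max ?leqnn ?orbT // mulr_sumr.
by apply: eq_bigr => m _; rewrite mcoeffZ mulrA.
Qed.

Lemma mnmfun0 : mnmfun 0 = 0.
Proof. by rewrite -(scale0r 0) mnmfunZ mul0r. Qed.

Lemma mnmfun_sum (I : Type) (s : seq I) (Q : pred I) (F : I -> {mpoly C[n]}) :
  mnmfun (\sum_(i <- s | Q i) F i) = \sum_(i <- s | Q i) mnmfun (F i).
Proof. exact: (big_morph _ mnmfunD mnmfun0). Qed.

Lemma mnmfunX m : mnmfun 'X_[m] = g m.
Proof. by rewrite /mnmfun msuppX big_seq1 mcoeffX eqxx mul1r. Qed.

End MonomialFunctional.

(** * Lifting Laurent polynomials to polynomials in the vertex variables *)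

Section Representation.

Variables (C : numClosedFieldType) (d : nat) (v : 'I_d.+1 -> 'rV[int]_d).

Definition mexp (m : 'X_{1.. d.+1}) : 'rV[int]_d := \sum_i v i *~ (m i)%:Z.

Lemma mexp0 : mexp 0%MM = 0.
Proof. by rewrite /mexp big1 // => i _; rewrite mnmE mulr0z. Qed.

Lemma mexp1 i : mexp U_(i)%MM = v i.
Proof.
rewrite /mexp (bigD1 i) //= big1 ?addr0 => [|j ji]; rewrite mnm1E.
  by rewrite eqxx mulr1z.
by rewrite eq_sym (negbTE ji) mulr0z.
Qed.

Lemma mexpD m m' : mexp (m + m')%MM = mexp m + mexp m'.
Proof.
by rewrite -big_split /=; apply: eq_bigr => i _; rewrite mnmE PoszD mulrzDr.
Qed.

(* [p] becomes [q] after forgetting [t_0] and writing the exponents of [t] as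
   nonnegative combinations of the [v i]; such a lift [q] is not unique, since
   the [v i] are linearly dependent. *)
Definition lifts_to (p : LP C d) (q : {mpoly C[d.+1]}) :=
  exists L : seq (C * 'X_{1.. d.+1}),
    [seq (x.1, x.2.2) | x <- p] = [seq (x.1, mexp x.2) | x <- L] /\
    q = \sum_(x <- L) x.1 *: 'X_[x.2].

Lemma lifts_mon c k m : lifts_to (lmon c (k, mexp m)) (c *: 'X_[m]).
Proof. by exists [:: (c, m)]; rewrite big_seq1. Qed.

Lemma lifts_one : lifts_to (lone C d) 1.
Proof. by have := lifts_mon 1 0 0%MM; rewrite mexp0 mpolyX0 scale1r. Qed.

Lemma lifts_zero : lifts_to (lzero C d) 0.
Proof. by exists [::]; rewrite big_nil. Qed.

Lemma lifts_add p q p' q' :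
  lifts_to p p' -> lifts_to q q' -> lifts_to (ladd p q) (p' + q').
Proof.
move=> [L [pL ->]] [L' [qL ->]]; exists (L ++ L').
by rewrite !map_cat pL qL big_cat.
Qed.

Lemma lifts_scale c p p' : lifts_to p p' -> lifts_to (lscale c p) (c *: p').
Proof.
move=> [L [pL ->]]; exists [seq (c * x.1, x.2) | x <- L]; split.
  have := congr1 (map (fun x => (c * x.1, x.2))) pL.
  by rewrite /lscale -!map_comp.
by rewrite big_map scaler_sumr; apply: eq_bigr => x _; rewrite scalerA.
Qed.

Lemma lifts_mul p q p' q' :
  lifts_to p p' -> lifts_to q q' -> lifts_to (lmul p q) (p' * q').
Proof.
move=> [L [pL ->]] [L' [qL ->]].
exists [seq (x.1 * y.1, (x.2 + y.2)%MM) | x <- L, y <- L']; split; last first.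
  rewrite big_allpairs_dep big_distrlr /=; apply: eq_bigr => x _.
  apply: eq_bigr => y _.
  by rewrite mpolyXD -scalerAl -scalerAr scalerA.
pose h (x y : C * 'rV[int]_d) := (x.1 * y.1, x.2 + y.2).
have -> : [seq (x.1, x.2.2) | x <- lmul p q] =
    [seq h x y | x <- [seq (x.1, x.2.2) | x <- p],
                 y <- [seq (x.1, x.2.2) | x <- q]].
  by rewrite allpairs_mapl allpairs_mapr map_allpairs.
rewrite pL qL allpairs_mapl allpairs_mapr map_allpairs.
by apply: eq_allpairs => // x y; rewrite /h /= mexpD.
Qed.

Lemma lifts_det k (A : 'I_k -> 'I_k -> LP C d) (B : 'M[{mpoly C[d.+1]}]_k) :
  (forall i j, lifts_to (A i j) (B i j)) -> lifts_to (ldet A) (\det B).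
Proof.
move=> AB; apply: (big_ind2 lifts_to); first exact: lifts_zero.
  by move=> *; apply: lifts_add.
move=> s _; rewrite mulr_sign.
have -> (x : {mpoly C[d.+1]}) : (if s : bool then - x else x) = (-1) ^+ s *: x.
  by case: (s : bool); rewrite ?scaleN1r ?scale1r.
apply: lifts_scale; apply: (big_ind2 lifts_to); first exact: lifts_one.
  by move=> *; apply: lifts_mul.
by move=> i _.
Qed.

(** [resval] ignores the power of [t_0], and [r \o mexp] depends only on the exponent of [t]; hence
    every lift computes the same value. *)
Lemma resval_lifts r p q :
  lifts_to p q -> resval r p = mnmfun (r \o mexp) q.
Proof.
move=> [L [pL ->]]; rewrite mnmfun_sum /resval.
have -> : \sum_(x <- p) x.1 * r x.2.2 =
    \sum_(x <- [seq (x.1, x.2.2) | x <- p]) x.1 * r x.2 by rewrite big_map.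
by rewrite pL big_map; apply: eq_bigr => x _; rewrite mnmfunZ mnmfunX.
Qed.

End Representation.

Lemma mulmxzE m n (A : 'M[int]_(m, n)) (z : int) i j : (A *~ z) i j = z * A i j.
Proof.
case: z => k; first by rewrite -pmulrn mulmxnE -mulr_natl natz.
by rewrite NegzE mulrNz -pmulrn mxE mulmxnE -mulr_natl natz mulNr.
Qed.

(** * Homogeneous coordinates of the vertices and the volume of the simplex *)

Section Simplex.

Variables (d : nat) (w : 'I_d.+1 -> nat) (v : 'I_d.+1 -> 'rV[int]_d).
Hypothesis w_gt0 : forall i, (0 < w i)%N.
Hypothesis gcd_w : \big[gcdn/0%N]_i w i = 1%N.
Hypothesis v_gen :
  forall m : 'rV[int]_d, exists c : 'I_d.+1 -> int, m = \sum_i v i *~ c i.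
Hypothesis wv0 : \sum_i v i *~ (w i)%:Z = 0.

Let W := (\sum_i w i)%N.

Lemma sum_w_gt0 : (0 < W)%N.
Proof. by rewrite /W big_ord_recl ltn_addr. Qed.

Definition hmx : 'M[int]_d.+1 :=
  \matrix_(i, j) if unlift ord0 j is Some j' then v i 0 j' else 1.

Lemma hmx0 i : hmx i ord0 = 1.
Proof. by rewrite mxE unlift_none. Qed.

Lemma hmxS i j : hmx i (lift ord0 j) = v i 0 j.
Proof. by rewrite mxE liftK. Qed.

Lemma sum_wv j : \sum_i (w i)%:Z * v i 0 j = 0.
Proof.
have := congr1 (fun m : 'rV_d => m 0 j) wv0; rewrite summxE mxE => vE; rewrite -[RHS]vE.
by apply: eq_bigr => i _; rewrite mulmxzE.
Qed.

Lemma sum_whmx j : \sum_i (w i)%:Z * hmx i j = W%:Z *+ (j == ord0).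
Proof.
case: (unliftP ord0 j) => [j'|] ->.
  by under eq_bigr => l _ do rewrite hmxS; rewrite sum_wv.
rewrite eqxx mulr1n /W (big_morph Posz PoszD (erefl 0%:Z)).
by apply: eq_bigr => i _; rewrite hmx0 mulr1.
Qed.

(** Let the first row of [B] be [w] and let its other rows express the standard basis in the
    generators [v i]. Then [B *m hmx] is lower triangular with diagonal (W, 1, ..., 1). *)
Lemma hmx_det_dvd : (\det hmx %| W%:Z)%Z.
Proof.
have [c cE] : exists c : 'I_d -> 'I_d.+1 -> int,
    forall j, delta_mx 0 j = \sum_i v i *~ c j i.
  by apply: (@fin_all_exists _ _ (fun j (c : 'I_d.+1 -> int) =>
    delta_mx 0 j = \sum_i v i *~ c i)) => j; apply: v_gen.
pose B : 'M[int]_d.+1 :=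
  \matrix_(i, l) if unlift ord0 i is Some i' then c i' l else (w l)%:Z.
have BA0 j : (B *m hmx) ord0 j = W%:Z *+ (j == ord0).
  rewrite -sum_whmx mxE; apply: eq_bigr => l _.
  by rewrite [B _ _]mxE unlift_none.
have BAS i j : (B *m hmx) (lift ord0 i) (lift ord0 j) = (i == j)%:R.
  have := congr1 (fun m : 'rV_d => m 0 j) (cE i).
  rewrite summxE mxE eqxx /= eq_sym => ->; rewrite mxE; apply: eq_bigr => l _.
  by rewrite hmxS [B _ _]mxE liftK mulmxzE.
have trigBA : is_trig_mx (B *m hmx).
  apply/is_trig_mxP => i j ij.
  case: (unliftP ord0 j) ij => [j'|] -> ij //.
  case: (unliftP ord0 i) ij => [i'|] -> ij; last by rewrite BA0.
  rewrite BAS; case: eqP => // ij'; move: ij; rewrite ij'.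
  by rewrite ltnn.
apply/dvdzP; exists (\det B); rewrite -det_mulmx (det_trig trigBA).
rewrite big_ord_recl BA0 eqxx mulr1n big1 ?mulr1 // => i _.
by rewrite BAS eqxx.
Qed.

(** Multiplying w A = (W, 0, ..., 0) by the adjugate of A shows that W divides each [w l] times the
    determinant; the [w l] have gcd 1. *)
Lemma dvd_hmx_det : (W%:Z %| \det hmx)%Z.
Proof.
rewrite dvdzE -[X in (_ %| X)%N]mul1n -gcd_w.
apply: dvdn_mul_biggcd => l.
have : ((\row_i (w i)%:Z) *m hmx *m \adj hmx) 0 l = (w l)%:Z * \det hmx.
  by rewrite -mulmxA mul_mx_adj mul_mx_scalar !mxE mulrC.
rewrite mxE (bigD1 ord0) //= big1 ?addr0 => [|j j0]; last first.
  rewrite [X in X * _]mxE; under eq_bigr => k _ do rewrite [X in X * _]mxE.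
  by rewrite sum_whmx (negbTE j0) mul0r.
rewrite [X in X * _]mxE; under eq_bigr => k _ do rewrite [X in X * _]mxE.
rewrite sum_whmx eqxx mulr1n => /(congr1 absz); rewrite !abszM /= => <-.
exact: dvdn_mulr.
Qed.

Lemma simplex_volE : simplex_vol v = W%:Z.
Proof.
rewrite /simplex_vol -/hmx -abszE; congr Posz; apply/eqP.
by have := hmx_det_dvd; have := dvd_hmx_det; rewrite !dvdzE eqn_dvd => -> ->.
Qed.

Lemma hmx_det_sqr : \det hmx ^+ 2 = W%:Z ^+ 2.
Proof. by rewrite -simplex_volE /simplex_vol -/hmx real_normK ?num_real. Qed.

(** * Relations satisfied by a toric residue *)

Section Relations.

Variable C : numClosedFieldType.

Lemma sum_wC_neq0 : W%:R != 0 :> C.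
Proof. by rewrite pnatr_eq0 -lt0n sum_w_gt0. Qed.

Lemma hmxC_unit : map_mx intr hmx \in @unitmx C d.+1.
Proof.
rewrite unitmxE unitfE det_map_mx intr_eq0 -sqrf_eq0 hmx_det_sqr sqrf_eq0.
by rewrite eqz_nat -lt0n sum_w_gt0.
Qed.

(** Subtracting the multiple of [w] with the same coordinate sum leaves a row vector killed by the
    vertex matrix, which is invertible over [C]. *)
Lemma relation_prop_w (x : 'I_d.+1 -> C) :
  (forall j, \sum_i x i * (v i 0 j)%:~R = 0) ->
  forall i, x i = (w i)%:R / W%:R * \sum_l x l.
Proof.
move=> xv i; set s := \sum_l x l.
pose z : 'rV[C]_d.+1 := \row_l (x l - (w l)%:R / W%:R * s).
suff z0 : z = 0.
  have := congr1 (fun m : 'rV_d.+1 => m 0 i) z0; rewrite !mxE => /eqP.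
  by rewrite subr_eq0 => /eqP.
rewrite -[z](mulmxK hmxC_unit) -[RHS](mul0mx _ (invmx (map_mx intr hmx))).
congr (_ *m _); apply/rowP => j; rewrite !mxE.
transitivity (\sum_l x l * (hmx l j)%:~R -
    s / W%:R * (\sum_l (w l)%:Z * hmx l j)%:~R).
  rewrite (rmorph_sum intr) /= mulr_sumr -sumrB; apply: eq_bigr => l _ /=.
  rewrite [z _ _]mxE [map_mx _ _ _ _]mxE intrM -pmulrn.
  by set h := (hmx l j)%:~R; ring.
rewrite sum_whmx; case: (unliftP ord0 j) => [j'|] ->.
  by under eq_bigr => l _ do rewrite hmxS; rewrite xv mulr0 subr0.
under eq_bigr => l _ do rewrite hmx0 mulr1; rewrite eqxx mulr1n -/s -pmulrn.
by rewrite divfK ?subrr // sum_wC_neq0.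
Qed.

(** A family stable under every [tdop i], containing f and hence all entries of M_f. The constant
    term stays in the list even when its coefficient is 0, so that this stability is an equality of
    lists. *)
Definition fshape (c : C) (b : 'I_d.+1 -> C) : LP C d :=
  ladd (lmon c (0%N, 0)) [seq (b l, (0%N, v l)) | l <- enum 'I_d.+1].

Lemma tdop_fshape i c b :
  tdop i (fshape c b) =
  fshape (c * (i == ord0)%:R) (fun l => b l * (hmx l i)%:~R).
Proof.
case: (unliftP ord0 i) => [j|] ->; rewrite /tdop ?liftK ?unlift_none.
  rewrite /fshape /ltder /ladd /= -map_comp mxE.
  congr (_ :: _); apply: eq_map => l /=; by rewrite hmxS.
rewrite eqxx mulr1 /fshape; congr (_ ++ _).
by apply: eq_map => l; rewrite hmx0 mulr1.
Qed.

Lemma sum_fshape c b (h : 'rV[int]_d -> C) :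
  \sum_(x <- fshape c b) x.1 * h x.2.2 = c * h 0 + \sum_l b l * h (v l).
Proof. by rewrite big_cons /= big_map big_enum. Qed.

Lemma lifts_fshape c b :
  lifts_to v (fshape c b) (c%:MP + \sum_l b l *: 'X_l).
Proof.
exists ((c, 0%MM) :: [seq (b l, U_(l)%MM) | l <- enum 'I_d.+1]); split.
  rewrite /= mexp0 -!map_comp; congr (_ :: _).
  by apply: eq_map => l /=; rewrite mexp1.
by rewrite big_cons big_map big_enum /= mpolyX0 -mul_mpolyC mulr1.
Qed.

Variable a : 'I_d.+1 -> C.

Lemma fpolE : fpol v a = fshape 1 (fun l => - a l).
Proof. by []. Qed.

Lemma resval_shift (r : 'rV[int]_d -> C) q k m :
  resval r (lmul (lmul (lmon 1 (1%N, 0)) q) (lmon 1 (k, m))) =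
  \sum_(x <- q) x.1 * r (x.2.2 + m).
Proof.
rewrite /resval /lmul big_allpairs_dep big_allpairs_dep big_seq1.
by apply: eq_bigr => x _; rewrite big_seq1 /= mulr1 mul1r add0r.
Qed.

Variable r : 'rV[int]_d -> C.
Hypothesis res_r : is_toric_residue v a r.

Definition vsum (u : 'I_d.+1 -> int) : 'rV[int]_d := \sum_i v i *~ u i.

(* [u + (k / W) w] are the barycentric coordinates of [vsum u] in
   [(d - 1) Delta]. *)
Lemma residue_step (u : 'I_d.+1 -> int) (k : nat) :
  \sum_i u i + k%:Z + 1 = d%:Z ->
  (forall i, 0 <= W%:Z * u i + k%:Z * (w i)%:Z) ->
  forall i, a i * r (v i + vsum u) = (w i)%:R / W%:R * r (vsum u).
Proof.
move=> sum_u u_ge0; have [res_F _] := res_r.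
(* The nonnegative quantities of the hypothesis add up to W (d - 1), so d is positive. *)
have [e de] : exists e, d = e.+1.
  have : 0 <= \sum_i (W%:Z * u i + k%:Z * (w i)%:Z).
    by apply: sumr_ge0 => i _.
  rewrite big_split /= -!mulr_sumr -(big_morph Posz PoszD (erefl 0%:Z)) -/W.
  have W_gt0 := sum_w_gt0 => sum_ge0; exists d.-1.
  suff : 0 <= \sum_i u i + k%:Z by lia.
  by rewrite -(pmulr_rge0 _ (_ : 0 < W%:Z)) // mulrDr [W%:Z * k%:Z]mulrC.
pose h : LP C d := lmon 1 (e, vsum u).
have lcoef_h x : lcoef h x != 0 -> x = (e, vsum u).
  by rewrite /lcoef big_cons big_nil /=; case: (_ =P x) => [<- //|_]; rewrite eqxx.
have inh : in_Sk v e h.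
  split=> x /lcoef_h -> //=; exists (fun i => (u i)%:~R + k%:R * (w i)%:R / W%:R).
  have Wn0 : W%:R != 0 :> rat by rewrite pnatr_eq0 -lt0n sum_w_gt0.
  split=> [i|].
    have -> : (u i)%:~R + k%:R * (w i)%:R / W%:R =
        (W%:Z * u i + k%:Z * (w i)%:Z)%:~R / W%:R :> rat.
      by rewrite intrD !intrM -!pmulrn; field.
    by rewrite divr_ge0 ?ler0z ?ler0n.
  split.
    rewrite big_split /= -mulr_suml -mulr_sumr -natr_sum -/W mulfK //.
    have -> : e%:R = (e%:Z)%:~R :> rat by rewrite -pmulrn.
    rewrite -(rmorph_sum intr) /= pmulrn -intrD; congr _%:~R.
    by move: sum_u de; set s := \sum_i u i; clearbody s; lia.
  move=> j; rewrite /vsum summxE.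
  under [RHS]eq_bigr => l _ do rewrite mulrDl.
  rewrite big_split /= [X in _ + X](_ : _ = 0) ?addr0.
    rewrite (rmorph_sum intr); apply: eq_bigr => l _ /=.
    by rewrite mulmxzE intrM.
  transitivity (k%:R / W%:R * (\sum_l (w l)%:Z * v l 0 j)%:~R : rat).
    rewrite (rmorph_sum intr) mulr_sumr; apply: eq_bigr => l _ /=.
    by rewrite intrM -pmulrn; ring.
  by rewrite sum_wv mulr0.
have relF i : (i == ord0)%:R * r (vsum u) =
    \sum_l a l * r (v l + vsum u) * (hmx l i)%:~R.
  have := res_F e h (esym de) inh i.
  rewrite /Fgen resval_shift fpolE tdop_fshape.
  rewrite (sum_fshape _ _ (fun m => r (m + vsum u))) add0r mul1r => /eqP.
  rewrite addr_eq0 -sumrN => /eqP ->; apply: eq_bigr => l _.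
  by ring.
(* [F_0] identifies [r (vsum u)] with the sum of the unknowns [a l * r (v l + vsum u)]; the other
   [F_i] are the linear relations that [relation_prop_w] asks for. *)
have -> : r (vsum u) = \sum_l a l * r (v l + vsum u).
  have := relF ord0; rewrite eqxx mul1r => ->; apply: eq_bigr => l _.
  by rewrite hmx0 mulr1.
apply: relation_prop_w => j; have := relF (lift ord0 j).
rewrite mul0r => relFj; rewrite [RHS]relFj.
by apply: eq_bigr => l _; rewrite hmxS.
Qed.

Lemma residue_monomial (m : 'X_{1.. d.+1}) : (mdeg m <= d)%N ->
  (\prod_i a i ^+ m i) * r (mexp v m) =
  (\prod_i ((w i)%:R / W%:R) ^+ m i) * r 0.
Proof.
move: {2}(mdeg m) (erefl (mdeg m)) => k; elim: k m => [|k IHk] m.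
  move/eqP; rewrite mdeg_eq0 => /eqP -> _; rewrite mexp0.
  by rewrite !big1 // => i _; rewrite mnmE.
move=> deg_m; rewrite deg_m => le_kd.
have [i mi] : exists i, m i != 0%N.
  apply/existsP; apply: contraT; rewrite negb_exists => /forallP m0.
  suff m00 : m = 0%MM by rewrite m00 mdeg0 in deg_m.
  by apply/mnmP => i; rewrite mnmE; apply/eqP; have := m0 i; rewrite negbK.
have {mi} [m' mE] : exists m', m = (m' + U_(i))%MM.
  by exists (m - U_(i))%MM; rewrite submK // lep1mP.
have deg_m' : mdeg m' = k by move: deg_m; rewrite mE mdegD mdeg1; lia.
have prodE (b : 'I_d.+1 -> C) :
    \prod_i b i ^+ m i = (\prod_i b i ^+ m' i) * b i.
  transitivity (mmap1 b m) => //; rewrite mE commr_mmap1_M ?mmap1U //.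
  by move=> ? ?; apply: mulrC.
rewrite !prodE mE mexpD mexp1 addrC.
have -> : mexp v m' = vsum (fun i => (m' i)%:Z) by [].
(* [m'] has degree [k]; [d - k.+1] factors T complete it to degree d - 1. *)
rewrite -mulrA (@residue_step _ (d - k.+1)); last first.
- by move=> l; rewrite -!PoszM -PoszD.
- rewrite -(big_morph Posz PoszD (erefl 0%:Z)) -mdegE deg_m'.
  by lia.
have := IHk m' deg_m'; rewrite deg_m' => /(_ (ltnW le_kd)) IH.
by rewrite mulrCA IH; ring.
Qed.

(** * Exchanging vertices for the origin *)

Hypothesis dvd_wW : forall i, (w i %| W)%N.

Let c i : C := (w i)%:R / W%:R.
(** With this rescaling an exchange reads b_i r(v_i + m) = r(m), without constants. *)
Let b i : C := a i / c i.

Lemma w_over_W_neq0 i : c i != 0.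
Proof.
rewrite mulf_neq0 // ?invr_eq0 ?sum_wC_neq0 //.
by rewrite pnatr_eq0 -lt0n w_gt0.
Qed.

Lemma sum_w_over_W : \sum_i c i = 1.
Proof. by rewrite -mulr_suml -natr_sum -/W divff // sum_wC_neq0. Qed.

(* As [w i] divides [W], a coordinate of [u + (k / W) w] lying below [1] is at
   most [1 - w i / W]; these bounds add up to exactly [d]. *)
Lemma exists_coord_ge1 (u : 'I_d.+1 -> int) (k : nat) :
  (k.+1 < W)%N -> \sum_i u i + k%:Z = d%:Z ->
  exists i, W%:Z <= W%:Z * u i + k%:Z * (w i)%:Z.
Proof.
move=> lt_kW sum_u; apply/existsP; apply: contraT.
rewrite negb_exists => /forallP u_lt.
have slack_ge0 i : 0 <= W%:Z - (w i)%:Z - (W%:Z * u i + k%:Z * (w i)%:Z).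
  have /dvdnP[q Wq] := dvd_wW i; have := u_lt i.
  rewrite -ltNge Wq PoszM => lt_u.
  have w0 : 0 < (w i)%:Z by exact: w_gt0.
  have : q%:Z * u i + k%:Z < q%:Z by rewrite -(ltr_pM2r w0) mulrDl mulrAC.
  by rewrite -lezD1 -(ler_pM2r w0) => le_u; nia.
have sum0 : \sum_i (W%:Z - (w i)%:Z - (W%:Z * u i + k%:Z * (w i)%:Z)) = 0.
  rewrite !sumrB big_split /= -!mulr_sumr sumr_const card_ord pmulrn mulrzz.
  rewrite -(big_morph Posz PoszD (erefl 0%:Z)) -/W.
  have -> : \sum_i u i = d%:Z - k%:Z by rewrite -sum_u addrK.
  by lia.
have slack0 := psumr_eq0P (fun i _ => slack_ge0 i) sum0.
(* Vanishing slack means W (1 - u_i) = w_i (k + 1). By the gcd condition W then divides k + 1, which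
   is positive and less than W. *)
have dvd_W i : (W %| w i * k.+1)%N.
  apply/dvdnP; exists `|1 - u i|%N; have := slack0 i isT.
  have := w_gt0 i; have := sum_w_gt0; nia.
have := dvdn_mul_biggcd dvd_W; rewrite gcd_w mul1n => /(dvdn_leq (ltn0Sn k)).
by rewrite leqNgt lt_kW.
Qed.

Section NonzeroCoefficients.

Hypothesis a_neq0 : forall i, a i != 0.

Lemma rescaled_a_neq0 i : b i != 0.
Proof. by rewrite mulf_neq0 ?invr_eq0 ?w_over_W_neq0 ?a_neq0. Qed.

(** [u] describes the monomial reached after [k] exchanges, a point of d Delta. Its entries can
    become negative, so the invariant product makes sense only for nonzero coefficients. *)
Lemma residue_chain k : (k < W)%N ->
  exists u : 'I_d.+1 -> int,
    [/\ \sum_i u i + k%:Z = d%:Z,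
        forall i, 0 <= W%:Z * u i + k%:Z * (w i)%:Z &
        r (vsum u) * \prod_i b i ^ u i = r 0].
Proof.
elim: k => [|k IHk] lt_kW.
  (* Any product of d of the Z_i could start the chain; this is the d-th power of a single one. *)
  pose m : 'X_{1.. d.+1} := (U_(ord0) *+ d)%MM.
  have deg_m : mdeg m = d by rewrite /m mdegMn mdeg1 mul1n.
  exists (fun i => (m i)%:Z); split.
  - by rewrite addr0 -(big_morph Posz PoszD (erefl 0%:Z)) -mdegE deg_m.
  - by move=> i; rewrite -!PoszM -PoszD.
  - have := @residue_monomial m; rewrite deg_m leqnn => /(_ isT) res_m.
    have -> : \prod_i b i ^ (m i)%:Z = (\prod_i a i ^+ m i) / \prod_i c i ^+ m i.
      by rewrite -prodf_div; apply: eq_bigr => i _; rewrite -expr_div_n.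
    rewrite mulrA [_ * \prod_i _]mulrC res_m mulrAC divff ?mul1r //.
    by apply/prodf_neq0 => i _; rewrite expf_neq0 ?w_over_W_neq0.
have [u [sum_u u_ge0 res_u]] := IHk (ltnW lt_kW).
have [i u_i] := exists_coord_ge1 lt_kW sum_u.
pose u' l := u l - (l == i)%:Z.
have sum_u' : \sum_l u' l + k.+1%:Z = d%:Z.
  have sum1 : \sum_l (l == i)%:Z = 1.
    by rewrite (bigD1 i) //= eqxx big1 // => l /negbTE ->.
  by rewrite sumrB sum1 -[in RHS]sum_u -[k.+1]addn1 PoszD; ring.
(* The multiplier is [k], not [k.+1]: these are W times the coordinates in (d - 1) Delta of the
   common factor, to be multiplied by Z_i or by T. *)
have u'_ge0 l : 0 <= W%:Z * u' l + k%:Z * (w l)%:Z.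
  rewrite /u'; have := u_ge0 l; case: eqP => [->|_] /=; last by rewrite subr0.
  by move: u_i; lia.
exists u'; split=> // [l|].
  by apply: (le_trans (u'_ge0 l)); rewrite lerD2l; apply: ler_wpM2r; rewrite ?lez_nat.
have vu' : v i + vsum u' = vsum u.
  rewrite /vsum (bigD1 i) //= [in RHS](bigD1 i) //= addrA; congr (_ + _).
    by rewrite /u' eqxx mulrzBr mulr1z addrC subrK.
  by apply: eq_bigr => l li; rewrite /u' (negbTE li) subr0.
have bu' : \prod_l b l ^ u' l = (\prod_l b l ^ u l) / b i.
  rewrite (bigD1 i) //= [in RHS](bigD1 i) //= mulrAC; congr (_ * _).
    by rewrite /u' eqxx expfzDr ?rescaled_a_neq0.
  by apply: eq_bigr => l li; rewrite /u' (negbTE li) subr0.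
have := @residue_step u' k _ u'_ge0 i; rewrite vu' -/(c i) => step.
have {step} res_u' : r (vsum u') = b i * r (vsum u).
  rewrite /b mulrAC step; first by rewrite mulrAC divff ?w_over_W_neq0 ?mul1r.
  by rewrite -sum_u' -[k.+1]addn1 PoszD addrA.
by rewrite res_u' bu' -res_u [LHS]mulrC [LHS]mulrA divfK ?rescaled_a_neq0 // mulrC.
Qed.

End NonzeroCoefficients.

(** The end of the chain, after W - 1 exchanges, is forced: its exponents are 1 - w_i, and the part
    -w_i contributes nothing to the exponent of [t] because the w_i v_i sum to 0. This same part
    produces the factor b_i^(w_i). *)
Lemma residue_top :
  (\prod_i a i) * r (\sum_i v i) =
  (\prod_i c i) * (\prod_i b i ^+ w i) * r 0.
Proof.
(* If some coefficient vanishes, both sides are 0. *)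
have [/forallP a_neq0|] := boolP [forall i, a i != 0]; last first.
  rewrite negb_forall => /existsP[i]; rewrite negbK => /eqP ai0.
  rewrite (bigD1 i) //= ai0 !mul0r [X in _ * X * _](bigD1 i) //= /b ai0 mul0r.
  by rewrite expr0n eqn0Ngt w_gt0 mul0r mulr0 mul0r.
have W_gt0 := sum_w_gt0.
have [|u [sum_u u_ge0 res_u]] := residue_chain a_neq0 (k := W.-1).
  by rewrite ltn_predL.
(* Integrality sharpens W u_i + (W - 1) w_i >= 0 to u_i >= 1 - w_i, and the sums of both sides
   agree. *)
have slack_ge0 i : 0 <= u i + (w i)%:Z - 1.
  by have := u_ge0 i; have := w_gt0 i; nia.
have sum0 : \sum_i (u i + (w i)%:Z - 1) = 0.
  rewrite !sumrB big_split /= sumr_const card_ord natz.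
  rewrite -(big_morph Posz PoszD (erefl 0%:Z)) -/W.
  have -> : \sum_i u i = d%:Z - W.-1%:Z by rewrite -sum_u addrK.
  by lia.
have slack0 := psumr_eq0P (fun i _ => slack_ge0 i) sum0.
have uE i : u i = 1 - (w i)%:Z by have := slack0 i isT; lia.
have vu : vsum u = \sum_i v i.
  rewrite -[RHS]subr0 -[X in _ - X]wv0 -sumrB; apply: eq_bigr => i _.
  by rewrite uE mulrzBr mulr1z.
have bu : \prod_i b i ^ u i = (\prod_i a i) / (\prod_i c i) / \prod_i b i ^+ w i.
  rewrite -!prodf_div; apply: eq_bigr => i _.
  by rewrite uE expfzDr ?rescaled_a_neq0 // -exprnN.
rewrite -res_u vu bu.
have c_n0 : \prod_i c i != 0 by apply/prodf_neq0 => i _; apply: w_over_W_neq0.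
have bw_n0 : \prod_i b i ^+ w i != 0.
  by apply/prodf_neq0 => i _; rewrite expf_neq0 ?rescaled_a_neq0.
by field; rewrite c_n0 bw_n0.
Qed.

(** * Evaluation of the residue on H' and on P *)

Definition sqfree_mnm (Q : pred 'I_d.+1) : 'X_{1.. d.+1} :=
  (\sum_(i | Q i) U_(i))%MM.

Lemma mexp_sqfree Q : mexp v (sqfree_mnm Q) = \sum_(i | Q i) v i.
Proof.
rewrite /sqfree_mnm (big_morph _ (mexpD v) (mexp0 v)).
by apply: eq_bigr => i _; rewrite mexp1.
Qed.

Lemma mdeg_sqfree Q : mdeg (sqfree_mnm Q) = #|Q|.
Proof. by rewrite mdeg_sum -sum1_card; apply: eq_bigr => i _; rewrite mdeg1. Qed.

Lemma prod_sqfree Q (h : 'I_d.+1 -> C) :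
  \prod_i h i ^+ sqfree_mnm Q i = \prod_(i | Q i) h i.
Proof.
have mmapD : {morph mmap1 h : m m' / (m + m')%MM >-> m * m'}.
  by move=> m m'; apply: commr_mmap1_M => ? ?; apply: mulrC.
transitivity (mmap1 h (sqfree_mnm Q)) => //.
rewrite /sqfree_mnm (big_morph _ mmapD (mmap11 h)).
by apply: eq_bigr => i _; rewrite mmap1U.
Qed.

Lemma mnmfun_prod (Q : pred 'I_d.+1) :
  mnmfun (r \o mexp v) (\prod_(i | Q i) (- a i *: 'X_i)) =
  (-1) ^+ #|Q| * ((\prod_(i | Q i) a i) * r (\sum_(i | Q i) v i)).
Proof.
rewrite scaler_prod mprodXE mnmfunZ mnmfunX /= prodrN -mulrA.
by rewrite -mexp_sqfree.
Qed.

Let A : 'M[{mpoly C[d.+1]}]_d.+1 := map_mx (@mpolyC d.+1 C) (map_mx intr hmx).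
Let D i : {mpoly C[d.+1]} := - a i *: 'X_i.

(* The vertex at the origin has homogeneous coordinates [(1, 0) = c A], so that
   [M_f] is congruent, via [A], to a rank one perturbation of a diagonal
   matrix. *)
Lemma lifts_Mf :
  lifts_to v (ldet (Mf v a)) (\det (A^T *m
    (\matrix_(i, j) (D i *+ (i == j) + (c i)%:MP * (c j)%:MP)) *m A)).
Proof.
apply: lifts_det => i j; rewrite /Mf fpolE !tdop_fshape.
set E := \matrix_(_, _) _.
have EE : E = diag_mx (\row_i D i) + (\row_i (c i)%:MP)^T *m (\row_i (c i)%:MP).
  apply/matrixP => k l; rewrite !mxE big_ord1 !mxE eq_sym.
  by case: eqP => [->|].
have cA : (\row_i (c i)%:MP) *m A = \row_k ((k == ord0)%:R)%:MP.
  apply/rowP => k; rewrite !mxE.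
  transitivity ((\sum_l c l * (hmx l k)%:~R)%:MP : {mpoly C[d.+1]}).
    rewrite (raddf_sum (@mpolyC d.+1 C)); apply: eq_bigr => l _ /=.
    by rewrite [(\row__ _) _ _]mxE [A _ _]mxE [map_mx _ _ _ _]mxE -mpolyCM.
  congr mpolyC; transitivity (W%:R^-1 * (\sum_l (w l)%:Z * hmx l k)%:~R : C).
    rewrite (rmorph_sum intr) mulr_sumr; apply: eq_bigr => l _ /=.
    by rewrite intrM -pmulrn /c mulrCA mulrA.
  rewrite sum_whmx; case: (k == ord0); rewrite ?mulr0 // mulr1n -pmulrn.
  by rewrite mulVf ?sum_wC_neq0.
rewrite EE mulmxDr mulmxDl mulmxA -trmx_mul -[(_ *m A)^T *m _ *m A]mulmxA cA.
(* Only the top left entry of M_f has a constant term, that of f itself. *)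
have -> : (A^T *m diag_mx (\row_i D i) *m A +
    (\row_k ((k == ord0)%:R)%:MP)^T *m (\row_k ((k == ord0)%:R)%:MP)) i j =
    (1 * (j == ord0)%:R * (i == ord0)%:R)%:MP +
    \sum_l (- a l * (hmx l j)%:~R * (hmx l i)%:~R) *: 'X_l.
  rewrite mxE addrC; congr (_ + _).
    by rewrite mxE big_ord1 !mxE mul1r -mpolyCM mulrC.
  rewrite mul_mx_diag mxE; apply: eq_bigr => l _.
  rewrite [X in X * _]mxE [A^T _ _]mxE ![A _ _]mxE ![map_mx _ _ _ _]mxE.
  rewrite [(\row__ _) _ _]mxE /D !mul_mpolyC -scalerAl [X in _ *: X]mulrC.
  by rewrite mul_mpolyC !scalerA; congr (_ *: _); ring.
exact: lifts_fshape.
Qed.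

(** The determinant of A enters squared, giving W^2. The rank one terms are products of d distinct
    Z_i and add up by the identity sum of c_i = 1; the product of all the D_i is evaluated by
    [residue_top]. *)
Lemma resval_Hprime :
  resval r (Hprime v a) =
  (-1) ^+ d * W%:R ^+ 2 * (\prod_i c i) * (1 - \prod_i b i ^+ w i) * r 0.
Proof.
have lifts_H := lifts_mul (lifts_mon v 1 d 0%MM) lifts_Mf.
rewrite mexp0 in lifts_H; rewrite (resval_lifts r lifts_H) mpolyX0 scale1r mul1r.
rewrite !det_mulmx det_tr mulrAC -expr2 /A !det_map_mx -![in LHS]rmorphXn /=.
rewrite hmx_det_sqr.
rewrite mul_mpolyC mnmfunZ det_diag_rank1 mnmfunD mnmfun_sum /D mnmfun_prod.
have term j : mnmfun (r \o mexp v) ((c j)%:MP * (c j)%:MP *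
      \prod_(i | i != j) (- a i *: 'X_i)) =
    (-1) ^+ d * (\prod_i c i) * r 0 * c j.
  rewrite -mpolyCM mul_mpolyC mnmfunZ mnmfun_prod -mexp_sqfree -prod_sqfree.
  have card_j : #|[pred i | i != j]| = d by rewrite cardC1 card_ord.
  rewrite card_j residue_monomial ?mdeg_sqfree ?card_j // prod_sqfree.
  by rewrite [X in _ = _ * X * _ * _](bigD1 j) //=; ring.
rewrite (eq_bigr _ (fun j _ => term j)).
rewrite -mulr_sumr sum_w_over_W residue_top card_ord expr2 intrM -pmulrn exprS.
by ring.
Qed.

(** The normalisation on H', divided by W. The product form needs no prior knowledge that 1 - mu y
    is nonzero and in fact implies it. *)
Lemma residue_one :
  (-1) ^+ d * r 0 * ((\prod_i c i) * W%:R * (1 - \prod_i b i ^+ w i)) = 1.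
Proof.
have [_] := res_r; rewrite resval_Hprime simplex_volE -pmulrn => res_H.
apply: (mulfI sum_wC_neq0); rewrite mulr1 -[RHS]res_H.
by ring.
Qed.

Lemma resval_Psubst (P : {mpoly rat[d.+1]}) : homog_of_deg d P ->
  resval r (Psubst v a P) =
  ratr P.@[fun i => (w i)%:R] / W%:R ^+ d * r 0.
Proof.
move=> homP; rewrite /resval big_map mevalE rmorph_sum !mulr_suml /=.
rewrite !big_seq; apply: eq_bigr => m m_P.
(* Homogeneity makes the power of W the same for every monomial of [P]. *)
have Wd : W%:R ^+ d = \prod_i W%:R ^+ m i :> C.
  by rewrite prodrXr -mdegE (homP m m_P).
have cE : \prod_i c i ^+ m i = ratr (\prod_i (w i)%:R ^+ m i) / W%:R ^+ d.
  rewrite Wd rmorph_prod -prodf_div; apply: eq_bigr => i _ /=.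
  by rewrite rmorphXn /= ratr_nat expr_div_n.
rewrite /= -[X in r X]/(mexp v m) -[LHS]mulrA residue_monomial ?(homP m) //.
rewrite cE [ratr (_ * _)]rmorphM /=.
by move: (ratr _) (ratr _) (_ ^-1) => x y z; ring.
Qed.

End Relations.
End Simplex.

Theorem mainTheorem8 (C : numClosedFieldType) (d : nat)
    (w : 'I_d.+1 -> nat) (v : 'I_d.+1 -> 'rV[int]_d)
    (P : {mpoly rat[d.+1]}) (a : 'I_d.+1 -> C) :
  (forall i, (0 < w i)%N) ->
  \big[gcdn/0%N]_(i < d.+1) w i = 1%N ->
  (forall i, w i %| \sum_(j < d.+1) w j)%N ->
  (forall m : 'rV[int]_d, exists c : 'I_d.+1 -> int, m = \sum_i v i *~ c i) ->
  \sum_i v i *~ (w i)%:Z = 0 ->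
  homog_of_deg d P ->
  Delta_regular v a ->
  forall r : 'rV[int]_d -> C, is_toric_residue v a r ->
  (-1) ^+ d * resval r (Psubst v a P) =
    ((\prod_i (w i)%:R)^-1 * ratr (P.@[fun i => (w i)%:R]))
    / (1 - ((\sum_j w j)%:R ^+ (\sum_j w j) / \prod_i ((w i)%:R ^+ w i))
           * \prod_i a i ^+ w i).
Proof.
move=> w_gt0 gcd_w dvd_wW v_gen wv0 homP _ r res_r.
have W_n0 := sum_wC_neq0 w_gt0 C.
rewrite (resval_Psubst w_gt0 gcd_w v_gen wv0 res_r homP).
have := residue_one w_gt0 gcd_w v_gen wv0 res_r dvd_wW.
set W := (\sum_i w i)%N in W_n0 *.
have -> : \prod_i ((w i)%:R / W%:R : C) = (\prod_i (w i)%:R) / W%:R ^+ d.+1.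
  by rewrite prodf_div prodr_const card_ord.
(* This product is mu y, since the exponents w_i of W add up to W. *)
have -> : \prod_i (a i / ((w i)%:R / W%:R)) ^+ w i =
    (W%:R ^+ W / \prod_i (w i)%:R ^+ w i) * \prod_i a i ^+ w i.
  rewrite [in X in W%:R ^+ X]/W -prodrXr -prodf_div -big_split /=.
  by apply: eq_bigr => i _; rewrite invf_div exprMn expr_div_n mulrC.
set Y := 1 - _; set p := \prod_i _; set z := ratr _ => res1.
have p_n0 : p != 0 by apply/prodf_neq0 => i _; rewrite pnatr_eq0 -lt0n w_gt0.
(* Were 1 - mu y zero, the normalisation would read 0 = 1. *)
have Y_n0 : Y != 0.
  by apply: contra_eq_neq res1 => ->; rewrite !mulr0 eq_sym oner_neq0.
apply: (mulIf (mulf_neq0 p_n0 Y_n0)).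
have -> : p^-1 * z / Y * (p * Y) = z by field; rewrite Y_n0 p_n0.
rewrite -[RHS]mulr1 -[X in _ = _ * X]res1 exprS.
by field; rewrite expf_neq0 // W_n0.
Qed.
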